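(* Let $t\in\mathbb{R}$ and $(a,b)\in\mathbb{H}_t$. The element $M_{(a,b)}$ is self-adjoint in $\mathcal{M}_t$ (i.e. $M_{(a,b)}^{*}=M_{(a,b)}$) if and only if $(a,b)=(\mathrm{Re}(a),0)$ in $\mathbb{H}_t$, if and only if $a\in\mathbb{R}$ and $b=0$ in $\mathbb{C}$.
   Context: For $t\in\mathbb{R}$, the $t$-scaled hypercomplex ring $\mathbb{H}_t$ is the set $\mathbb{C}^2$ with the usual vector addition and the multiplication $(a_1,b_1)\cdot_t(a_2,b_2)=(a_1a_2+t\,b_1\overline{b_2},\;a_1b_2+b_1\overline{a_2})$, regarded also as a vector space over $\mathbb{R}$; $(a,b)^{\dagger}=(\overline{a},-b)$. For $\eta\in\mathbb{H}_t$, $M_\eta:\mathbb{H}_t\to\mathbb{H}_t$ is the $\mathbb{R}$-linear multiplication operator $M_\eta(h)=\eta\cdot_t h$. The hypercomplex algebra over $\mathbb{R}$ is $\mathcal{M}_t=\{M_\eta:\eta\in\mathbb{H}_t\}$, with operator addition and composition and with adjoint $M_\eta^{*}=M_{\eta^{\dagger}}$. *)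

(* Defs.v *)
From HB Require Import structures.
From mathcomp Require Import all_boot all_order all_algebra all_field.
From mathcomp Require Import complex reals ring.

Set Implicit Arguments.
Unset Strict Implicit.
Unset Printing Implicit Defensive.

Import Order.TTheory GRing.Theory Num.Theory.

Local Open Scope ring_scope.
Local Open Scope complex_scope.

(* The parameter t does not occur in the carrier; it only selects the product. *)
Definition hypercomplex (R : realType) (t : R) : Type := (R[i] * R[i])%type.

HB.instance Definition _ (R : realType) (t : R) :=
  GRing.Zmodule.copy (hypercomplex t) (R[i] * R[i])%type.

Section HypercomplexRing.
Variables (R : realType) (t : R).
Local Notation H := (hypercomplex t).

Definition hmul (x y : H) : H :=
  (x.1 * y.1 + t%:C * (x.2 * y.2^*%C), x.1 * y.2 + x.2 * y.1^*%C).

Definition hone : H := (1, 0).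

(* The space is a real vector space: the scalars are in R, not in R[i]. *)
Definition hscale (r : R) (x : H) : H := (r%:C * x.1, r%:C * x.2).

Definition hdagger (x : H) : H := (x.1^*%C, - x.2).

Let conjcD (x y : R[i]) : (x + y)^*%C = x^*%C + y^*%C :> R[i].
Proof. exact: (rmorphD conjc). Qed.

Let conjcM (x y : R[i]) : (x * y)^*%C = x^*%C * y^*%C :> R[i].
Proof. exact: (rmorphM conjc). Qed.

Lemma hmulA : associative hmul.
Proof.
move=> [a b] [c d] [e f]; rewrite /hmul [LHS]/= [RHS]/=.
by rewrite !(conjcD, conjcM, conjcK, conjc_real); congr (_, _); ring.
Qed.

Lemma hmul1 : left_id hone hmul.
Proof. by case=> a b; rewrite /hmul /= !mul0r !mulr0 !mul1r !addr0. Qed.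

Lemma hmulr1 : right_id hone hmul.
Proof.
case=> a b; rewrite /hmul /=.
by rewrite !oppr0 !(mulr0, mulr1) add0r addr0.
Qed.

Lemma hmulDl : left_distributive hmul +%R.
Proof.
move=> [a b] [c d] [e f]; rewrite /hmul /= !mulrDl !mulrDr.
by congr (_, _); rewrite addrACA.
Qed.

Lemma hmulDr : right_distributive hmul +%R.
Proof.
move=> [a b] [c d] [e f]; rewrite /hmul /= !conjcD !mulrDr.
by congr (_, _); rewrite addrACA.
Qed.

Lemma hone_neq0 : hone != 0.
Proof. by apply/eqP => -[] /eqP; rewrite oner_eq0. Qed.

HB.instance Definition _ := GRing.Zmodule_isNzRing.Build H
  hmulA hmul1 hmulr1 hmulDl hmulDr hone_neq0.

Lemma hscaleA r s x : hscale r (hscale s x) = hscale (r * s) x.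
Proof. by rewrite /hscale /= rmorphM !mulrA. Qed.

Lemma hscale1 : left_id 1 hscale.
Proof. by case=> a b; rewrite /hscale /= rmorph1 !mul1r. Qed.

Lemma hscaleDr : right_distributive hscale +%R.
Proof. by move=> r [a b] [c d]; rewrite /hscale /= !mulrDr. Qed.

Lemma hscaleDl x : {morph hscale^~ x : r s / r + s}.
Proof. by move=> r s; rewrite /hscale rmorphD !mulrDl. Qed.

HB.instance Definition _ := GRing.Zmodule_isLmodule.Build R H
  hscaleA hscale1 hscaleDr hscaleDl.

Lemma hscaleAl (r : R) (x y : H) : r *: (x * y) = (r *: x) * y.
Proof.
rewrite -[LHS]/(hscale _ (hmul _ _)) -[RHS]/(hmul (hscale _ _) _).
by rewrite /hscale /hmul /= !mulrDr !mulrA [r%:C * t%:C]mulrC.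
Qed.

HB.instance Definition _ := GRing.Lmodule_isLalgebra.Build R H hscaleAl.

Lemma hscaleAr (r : R) (x y : H) : r *: (x * y) = x * (r *: y).
Proof.
rewrite -[LHS]/(hscale _ (hmul _ _)) -[RHS]/(hmul _ (hscale _ _)).
rewrite /hscale /hmul [LHS]/= [RHS]/= !(conjcM, conjc_real).
by congr (_, _); ring.
Qed.

HB.instance Definition _ := GRing.Lalgebra_isAlgebra.Build R H hscaleAr.

Lemma hypercomplex_vect : Vector.axiom 4 H.
Proof.
exists (fun x : H => \row_(i < 4)
          [:: complex.Re x.1; complex.Im x.1;
              complex.Re x.2; complex.Im x.2]`_i).
  move=> r [[a b] [c d]] [[a' b'] [c' d']]; apply/rowP => i.
  rewrite !mxE /=.
  by case: i => -[|[|[|[|//]]]] ? /=; rewrite !mul0r ?addr0 ?subr0.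
exists (fun v : 'rV[R]_4 => (v 0 0 +i* v 0 1, v 0 2%:R +i* v 0 3%:R) : H).
  by case=> -[a b] [c d]; rewrite !mxE.
move=> v; apply/rowP => i; rewrite mxE.
by case: i => -[|[|[|[|//]]]] ? /=; congr (v _ _); apply/val_inj.
Qed.

HB.instance Definition _ := Lmodule_hasFinDim.Build R H hypercomplex_vect.
HB.instance Definition _ := Algebra_isFalgebra.Build R H.

End HypercomplexRing.

Section HypercomplexAlgebra.
Variables (R : realType) (t : R).
Local Notation H := (hypercomplex t).

(* M_eta is amull eta : 'End(H), the R-linear map h |-> eta * h. *)
Definition hyperalg_vspace : {vspace 'End(H)} := limg (linfun (@amull R H)).

Definition hyperalg := subvs_of hyperalg_vspace.

Lemma memv_hyperalgP (T : 'End(H)) :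
  reflect (exists eta : H, T = amull eta) (T \in hyperalg_vspace).
Proof.
apply: (iffP memv_imgP) => [[eta _ ->]|[eta ->]]; exists eta.
- by rewrite lfunE.
- exact: memvf.
- by rewrite lfunE.
Qed.

Lemma amull_hyperalg (eta : H) : amull eta \in hyperalg_vspace.
Proof. by apply/memv_hyperalgP; exists eta. Qed.

Definition mulop (eta : H) : hyperalg := Subvs (amull_hyperalg eta).

Lemma mulopE (eta h : H) : vsval (mulop eta) h = hmul eta h.
Proof. by rewrite /= lfunE. Qed.

Lemma mulop_surj (T : hyperalg) : exists eta, T = mulop eta.
Proof.
by case/memv_hyperalgP: (subvsP T) => eta eqT; exists eta; apply: val_inj.
Qed.

Lemma mulopD (eta zeta : H) : mulop (eta + zeta) = mulop eta + mulop zeta.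
Proof. by apply: val_inj; rewrite /= linearD. Qed.

Lemma hyperalg_comp_subproof (S T : hyperalg) :
  (vsval S \o vsval T)%VF \in hyperalg_vspace.
Proof.
case: (mulop_surj S) (mulop_surj T) => eta -> [zeta ->].
by apply/memv_hyperalgP; exists (eta * zeta); rewrite amullM.
Qed.

Definition hyperalg_comp (S T : hyperalg) : hyperalg :=
  Subvs (hyperalg_comp_subproof S T).

Lemma mulopM (eta zeta : H) :
  mulop (eta * zeta) = hyperalg_comp (mulop eta) (mulop zeta).
Proof. by apply: val_inj; rewrite /= amullM. Qed.

(* The symbol eta of T = M_eta is unique, being T (1, 0). *)
Definition hyperalg_symbol (T : hyperalg) : H := vsval T 1.

Lemma mulopK : cancel mulop hyperalg_symbol.
Proof. by move=> eta; rewrite /hyperalg_symbol /= lfunE /= mulr1. Qed.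

Lemma hyperalg_symbolK : cancel hyperalg_symbol mulop.
Proof. by move=> T; case: (mulop_surj T) => eta ->; rewrite mulopK. Qed.

Definition adjoint (T : hyperalg) : hyperalg :=
  mulop (hdagger (hyperalg_symbol T)).

Lemma adjointE (eta : H) : adjoint (mulop eta) = mulop (hdagger eta).
Proof. by rewrite /adjoint mulopK. Qed.

Definition self_adjoint (T : hyperalg) : Prop := adjoint T = T.

End HypercomplexAlgebra.

Arguments mulop {R} t eta.

(* Main.v *)
Require Import Defs.
From mathcomp Require Import all_boot all_order all_algebra.
From mathcomp Require Import complex reals.

Import Order.TTheory GRing.Theory Num.Theory.

Local Open Scope ring_scope.
Local Open Scope complex_scope.

(** An element of the algebra is determined by its symbol, so M_(a, b) is
    self-adjoint exactly when the pair (a, b) is a fixed point of the involution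
    (a, b) |-> (conj a, - b).  In characteristic zero the second coordinate
    is then its own opposite only if it vanishes, and likewise the imaginary
    part of the first coordinate: this is [hdagger_fixP].  Finally, the
    order on the complex numbers compares only numbers with equal imaginary
    parts, so comparability with 0 also says that the imaginary part is zero:
    this is [complex_realE]. *)

Lemma complex_realE (R : rcfType) (z : R[i]) :
  (z \is Num.real) = (complex.Im z == 0).
Proof.
case: z => x y; rewrite realE !lecE /= [0 == y]eq_sym -andb_orr.
by rewrite -realE num_real andbT.
Qed.

Lemma eq_real_complexE (R : rcfType) (z : R[i]) :
  (z == (complex.Re z)%:C) = (complex.Im z == 0).
Proof. by case: z => x y; rewrite eq_complex /= eqxx. Qed.

Lemma conjc_fixE (R : rcfType) (z : R[i]) :
  (z^*%C == z) = (complex.Im z == 0).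
Proof. by case: z => x y; rewrite eq_complex /= eqxx eqNr. Qed.

Lemma hdagger_fixP (R : realType) (t : R) (a b : R[i]) :
  hdagger ((a, b) : hypercomplex t) = (a, b) <->
  complex.Im a = 0 /\ b = 0.
Proof.
rewrite /hdagger /=; split=> [[/eqP + /eqP]|[Ima0 ->]].
  by rewrite conjc_fixE eqNr => /eqP Ima0 /eqP b0.
by rewrite oppr0; congr (_, _); apply/eqP; rewrite conjc_fixE Ima0.
Qed.

(** Multiplication by eta sends the unit to eta, so distinct elements give
    distinct operators and the adjoint can be read off on symbols. *)
Lemma self_adjoint_mulop (R : realType) (t : R) (eta : hypercomplex t) :
  self_adjoint (mulop t eta) <-> hdagger eta = eta.
Proof.
rewrite /self_adjoint adjointE; split=> [|-> //].
exact: (can_inj (@mulopK R t)).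
Qed.

Theorem theorem5p5 (R : realType) (t : R) (a b : R[i]) :
  (self_adjoint (mulop t (a, b)) <->
     (a, b) = ((complex.Re a)%:C, 0) :> hypercomplex t) /\
  ((a, b) = ((complex.Re a)%:C, 0) :> hypercomplex t <->
     a \is Num.real /\ b = 0).
Proof.
have pairE : (a, b) = ((complex.Re a)%:C, 0) :> hypercomplex t <->
    complex.Im a = 0 /\ b = 0.
  split=> [[/eqP + ->]|[/eqP Ima0 ->]].
    by rewrite eq_real_complexE => /eqP.
  by congr (_, _); apply/eqP; rewrite eq_real_complexE.
split.
  apply: (iff_trans (self_adjoint_mulop R t (a, b))).
  exact: (iff_trans (hdagger_fixP R t a b) (iff_sym pairE)).
apply: (iff_trans pairE); rewrite complex_realE.
by split=> -[/eqP ? ?].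
Qed.
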